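(* For any finite metric space $X$ there exists $T>0$ such that for all $t>T$ the metric space $tX$ is strongly positive definite.
   Context: Metric spaces $(X,d)$ are finite and nonempty; $tX=(X,t\cdot d)$. The similarity matrix $Z\in\mathbb{R}^{X\times X}$ has entries $z_{ij}=e^{-d(i,j)}$; $X$ is positive definite if $Z$ is. Then the weighting is $\mathbf{w}=Z^{-1}\mathbf{1}$ ($\mathbf{1}$ the all-ones vector). $K=\tfrac12\big(I-\tfrac{\mathbf{1}\mathbf{1}^T}{n}\big)Z\big(I-\tfrac{\mathbf{1}\mathbf{1}^T}{n}\big)$ with $n=\#X$, $K^\dagger$ is its Moore--Penrose pseudoinverse, and $c_{ij}:=-(K^\dagger)_{ij}$ for $i\neq j$. $X$ is strongly positive definite if it is positive definite, $c>0$ (i.e. $c_{ij}>0$ for all distinct $i,j\in X$) and $\mathbf{w}>0$ (entrywise). *)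

(* Defs.v *)
From HB Require Import structures.
From mathcomp Require Import all_boot all_order all_algebra.
From mathcomp Require Import all_classical all_reals all_analysis.

Set Implicit Arguments.
Unset Strict Implicit.
Unset Printing Implicit Defensive.

Import Order.TTheory GRing.Theory Num.Theory.
Local Open Scope classical_set_scope.
Local Open Scope ring_scope.

(* Nonemptiness is not part of the structure. *)
#[short(type="finMetricType")]
HB.structure Definition FinMetric (R : numDomainType) :=
  { M of Finite M & Metric R M }.

(* The space tX: an alias of X carrying the metric t * d.  Only the finite type
   structure of X is inherited; the metric and its topology are new. *)
Definition rescale (R : realType) (t : {posnum R}) (X : finMetricType R) : Type :=
  X.

Section Rescale.
Variables (R : realType) (t : {posnum R}) (X : finMetricType R).

HB.instance Definition _ := Finite.on (rescale t X).

Let sdist (x y : rescale t X) : R := t%:num * mdist (x : X) (y : X).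

Let sdistxx x : sdist x x = 0.
Proof. by rewrite /sdist mdistxx mulr0. Qed.

Let sdist_positivity x y : sdist x y = 0 -> x = y.
Proof.
move=> /eqP; rewrite /sdist mulf_eq0 (gt_eqF (_ : 0 < t%:num)) //= => /eqP.
exact: mdist_positivity.
Qed.

Let sdist_sym x y : sdist x y = sdist y x.
Proof. by rewrite /sdist metric_sym. Qed.

Let sdist_triangle y x z : sdist x z <= sdist x y + sdist y z.
Proof. by rewrite /sdist -mulrDr ler_pM2l // metric_triangle. Qed.

HB.instance Definition _ := @isMetric.Build R (rescale t X) sdist
  sdistxx sdist_positivity sdist_sym sdist_triangle.

Lemma mdist_rescale (x y : rescale t X) :
  mdist x y = t%:num * mdist (x : X) (y : X).
Proof. by []. Qed.

End Rescale.

Definition posdefmx (R : numDomainType) n (A : 'M[R]_n) : Prop :=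
  A^T = A /\ forall v : 'cV[R]_n, v != 0 -> 0 < (v^T *m A *m v) 0 0.

(* The Moore-Penrose pseudoinverse over a real field (so that the adjoint is the
   transpose).  MathComp's pinvmx is only some partial inverse: it need not
   satisfy the two symmetry conditions. *)
Definition moore_penrose (R : realFieldType) m n
    (A : 'M[R]_(m, n)) (B : 'M[R]_(n, m)) : Prop :=
  [/\ A *m B *m A = A, B *m A *m B = B,
      (A *m B)^T = A *m B & (B *m A)^T = B *m A].

Definition mp_pinvmx (R : realFieldType) m n (A : 'M[R]_(m, n)) : 'M[R]_(n, m) :=
  xget 0 [set B | moore_penrose A B].

Section MoorePenroseTheory.
Variable R : realFieldType.

Lemma moore_penrose_unique m n (A : 'M[R]_(m, n)) B C :
  moore_penrose A B -> moore_penrose A C -> B = C.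
Proof.
move=> [B1 B2 B3 B4] [C1 C2 C3 C4].
have E : A *m B = A *m C.
  rewrite -{1}C1 -mulmxA -C3 -B3 -trmx_mul.
  by rewrite mulmxA B1 C3.
have F : B *m A = C *m A.
  rewrite -{1}C1 -[A *m C *m A]mulmxA mulmxA -B4 -C4 -trmx_mul.
  by rewrite -mulmxA [A *m (B *m A)]mulmxA B1 C4.
by rewrite -B2 F -mulmxA E mulmxA C2.
Qed.

Lemma gram_unitmx r n (B : 'M[R]_(r, n)) : row_free B -> B *m B^T \in unitmx.
Proof.
move=> Bfree; rewrite -row_free_unit -kermx_eq0; apply/eqP/row_matrixP => i.
rewrite row0; set u := row i _.
have uG : u *m (B *m B^T) = 0 by apply/sub_kermxP; rewrite row_sub.
have uB : u *m B = 0.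
  have : ((u *m B) *m (u *m B)^T) 0 0 = 0.
    by rewrite trmx_mul !mulmxA -(mulmxA u) uG mul0mx mxE.
  rewrite mxE => /eqP; rewrite psumr_eq0 => [/allP s0|j _]; last first.
    by rewrite [X in _ * X]mxE -expr2 sqr_ge0.
  apply/rowP => j; move/implyP: (s0 j (mem_index_enum _)) => /(_ isT).
  by rewrite [X in _ * X]mxE mulf_eq0 orbb mxE [RHS]mxE => /eqP.
by apply: (row_free_inj Bfree); rewrite uB mul0mx.
Qed.

Lemma moore_penrose_ex m n (A : 'M[R]_(m, n)) : exists B, moore_penrose A B.
Proof.
have := mulmx_base A; move: (row_base_free A) (col_base_full A).
move: (\rank A) (row_base A) (col_base A) => r B C Bfree Cfull /esym AE.
have Gu : B *m B^T \in unitmx by exact: gram_unitmx.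
have Hu : C^T *m C \in unitmx.
  by rewrite -{2}[C]trmxK; apply: gram_unitmx; rewrite /row_free mxrank_tr.
pose G := invmx (B *m B^T); pose H := invmx (C^T *m C).
have GT : G^T = G by rewrite /G trmx_inv trmx_mul trmxK.
have HT : H^T = H by rewrite /H trmx_inv trmx_mul trmxK.
pose P := B^T *m G *m (H *m C^T).
have AP : A *m P = C *m H *m C^T.
  rewrite AE /P -!mulmxA; congr (_ *m _).
  by rewrite !mulmxA mulmxV // mul1mx.
have PA : P *m A = B^T *m G *m B.
  rewrite AE /P -!mulmxA; congr (_ *m (_ *m _)).
  by rewrite (mulmxA C^T) mulmxA mulVmx // mul1mx.
exists P; split.
- by rewrite AP {1}AE -!mulmxA (mulmxA C^T) (mulmxA H) mulVmx // mul1mx -AE.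
- rewrite PA /P -!mulmxA; congr (_ *m (_ *m _)); rewrite !mulmxA.
  by rewrite mulmxV // mul1mx.
- by rewrite AP !trmx_mul trmxK HT mulmxA.
- by rewrite PA !trmx_mul trmxK GT mulmxA.
Qed.

Lemma mp_pinvmxP m n (A : 'M[R]_(m, n)) : moore_penrose A (mp_pinvmx A).
Proof. exact: (xgetPex 0 (moore_penrose_ex A)). Qed.

Lemma mp_pinvmx_eq m n (A : 'M[R]_(m, n)) B :
  moore_penrose A B -> mp_pinvmx A = B.
Proof. exact: moore_penrose_unique (mp_pinvmxP A). Qed.

End MoorePenroseTheory.

Section Similarity.
Variables (R : realType) (X : finMetricType R).

(* Rows and columns are indexed by 'I_#|X| through the enumeration of X. *)
Definition similaritymx : 'M[R]_#|X| :=
  \matrix_(i, j) expR (- mdist (enum_val i : X) (enum_val j : X)).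

Definition positive_definite : Prop := posdefmx similaritymx.

(* Meaningful when the similarity matrix is invertible: invmx A = A otherwise. *)
Definition weighting : 'cV[R]_#|X| := invmx similaritymx *m const_mx 1.

Definition centeringmx : 'M[R]_#|X| :=
  1%:M - (#|X|%:R)^-1 *: (const_mx 1 *m (const_mx 1 : 'cV[R]_#|X|)^T).

Definition Kmx : 'M[R]_#|X| :=
  2^-1 *: (centeringmx *m similaritymx *m centeringmx).

(* Only used off the diagonal. *)
Definition c_coef (x y : X) : R :=
  - mp_pinvmx Kmx (enum_rank x) (enum_rank y).

Definition strongly_positive_definite : Prop :=
  [/\ positive_definite,
      forall x y : X, x != y -> 0 < c_coef x y
    & forall x : X, 0 < weighting (enum_rank x) 0].

End Similarity.

(* Main.v *)
Require Import Defs.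
From mathcomp Require Import all_boot all_order all_algebra.
From mathcomp Require Import all_classical all_reals all_analysis.
From mathcomp Require Import lra.
Set Implicit Arguments.
Unset Strict Implicit.
Unset Printing Implicit Defensive.

Import Order.TTheory GRing.Theory Num.Theory.
Local Open Scope ring_scope.

(** As [t] grows, the off-diagonal entries [exp (- t * d (i, j))] of the
    similarity matrix [Z] of [tX] tend to [0], so [Z] tends to the identity, and
    every condition in strong positive definiteness becomes a strict inequality
    that holds with room to spare in the limit.

    Positive definiteness and the weighting are immediate from this: [Z] is
    strictly diagonally dominant, and [w] is close to the all-ones vector.  For
    [c], pseudoinversion is not continuous in general, but here it has a closed
    form: if [Z] is symmetric and invertible, with weighting [w] of nonzero total
    [s], then the pseudoinverse of [K] is [2 (Z^-1 - w w^T / s)]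
    ([moore_penrose_centered]).  Hence, for [i] different from [j],
      [c_ij = 2 (w_i w_j / s - (Z^-1)_ij)],
    which tends to [2 / n] because [Z^-1] tends to the identity.

    The limits are replaced by one explicit estimate
    ([near_identity_solution]): when all entries of [Z] are within [e] of those
    of the identity and [n e <= 1/2], the solution [x] of [Z x = b] is entrywise
    within [2 e (sum of |b_k|)] of [b].  It is applied to the all-ones vector
    and to the basis vectors, that is, to the columns of [Z^-1].  Closeness
    [e = 1 / (8 n)] suffices ([near_identity_strongly_posdef]), and it is reached
    once [t * d (x, y) >= 8 n] for all distinct [x], [y]. *)

Section NearIdentity.
Context {F : realFieldType} {n : nat}.
Implicit Types (e : F) (Z : 'M[F]_n).

Definition near_identity e Z := forall i j, `|Z i j - (i == j)%:R| <= e.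

(** With [S] the sum of the [|x_k|], the equation [x - b = - (Z - 1) x] gives
    [|x_i - b_i| <= e S]; summing over [i] bounds [S] by
    [sum of |b_k| + n e S], and half of [S] is absorbed on the left. *)
Lemma near_identity_solution e Z (x b : 'cV[F]_n) :
  near_identity e Z -> n%:R * e <= 2^-1 -> Z *m x = b ->
  forall i, `|x i 0 - b i 0| <= 2 * e * \sum_k `|b k 0|.
Proof.
move=> Znear ne Zx.
pose S := \sum_k `|x k 0|.
have row_bound i : `|x i 0 - b i 0| <= e * S.
  have -> : x i 0 - b i 0 = - \sum_k (Z i k - (i == k)%:R) * x k 0.
    rewrite -Zx mxE -opprB; congr (- _).
    under [RHS]eq_bigr do rewrite mulrBl.
    rewrite sumrB; congr (_ - _).
    rewrite (bigD1 i) //= eqxx mul1r big1 ?addr0 // => k ki.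
    by rewrite eq_sym (negPf ki) mul0r.
  rewrite normrN; apply: (le_trans (ler_norm_sum _ _ _)).
  rewrite mulr_sumr; apply: ler_sum => k _.
  by rewrite normrM ler_wpM2r.
have S_ge0 : 0 <= S by exact: sumr_ge0.
have S_le : S <= 2 * \sum_k `|b k 0|.
  have : S <= \sum_k `|b k 0| + n%:R * e * S.
    have -> : n%:R * e * S = \sum_(k < n) e * S.
      by rewrite sumr_const card_ord -mulrA mulr_natl.
    rewrite -big_split; apply: ler_sum => k _ /=.
    by have := row_bound k; have := lerB_dist (x k 0) (b k 0); lra.
  have := ler_wpM2r S_ge0 ne; lra.
move=> i; apply: (le_trans (row_bound i)).
have e_ge0 : 0 <= e by apply: le_trans (Znear i i).
by rewrite -mulrA mulrCA ler_wpM2l.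
Qed.

(** In absolute value, the quadratic form of [Z - 1] is at most [n e] times the
    squared norm. *)
Lemma near_identity_posdef e Z :
  Z^T = Z -> near_identity e Z -> n%:R * e < 1 -> posdefmx Z.
Proof.
move=> Zsym Znear ne; split=> // v v_neq0.
pose S := \sum_i v i 0 ^+ 2.
have S_gt0 : 0 < S.
  have S_ge0 : 0 <= S by apply: sumr_ge0 => i _; exact: sqr_ge0.
  rewrite lt_def S_ge0 andbT; apply: contra v_neq0.
  rewrite psumr_eq0 => [/allP S0|i _]; last exact: sqr_ge0.
  apply/eqP/colP => i; rewrite [RHS]mxE; apply/eqP.
  by have := S0 i (mem_index_enum _); rewrite sqrf_eq0.
have quadE : (v^T *m Z *m v) 0 0 =
    S + \sum_i \sum_j v i 0 * (Z i j - (i == j)%:R) * v j 0.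
  rewrite -mulmxA mxE -big_split; apply: eq_bigr => i _ /=.
  under [in RHS]eq_bigr do rewrite mulrBr mulrBl.
  rewrite sumrB [v^T _ _]mxE [(Z *m v) _ _]mxE mulr_sumr.
  under eq_bigr do rewrite mulrA.
  have -> : \sum_j v i 0 * (i == j)%:R * v j 0 = v i 0 ^+ 2.
    rewrite (bigD1 i) //= eqxx mulr1 -expr2 big1 ?addr0 // => j ji.
    by rewrite eq_sym (negPf ji) mulr0 mul0r.
  by rewrite addrC subrK.
(* |v_i v_j| <= (v_i^2 + v_j^2)/2, and these bounds add up to n * S. *)
have error_bound :
    - (n%:R * e * S) <= \sum_i \sum_j v i 0 * (Z i j - (i == j)%:R) * v j 0.
  have -> : - (n%:R * e * S) =
      \sum_(i < n) \sum_(j < n) - (e * (2^-1 * (v i 0 ^+ 2 + v j 0 ^+ 2))).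
    under eq_bigr do rewrite sumrN -2!mulr_sumr big_split /= sumr_const card_ord.
    rewrite sumrN -2!mulr_sumr big_split /= sumrMnl sumr_const card_ord -/S.
    by rewrite -[S *+ n]mulr_natl; lra.
  apply: ler_sum => i _; apply: ler_sum => j _.
  rewrite lerNl; apply: (le_trans (ler_norm _)).
  rewrite normrN mulrAC normrM mulrC; apply: ler_pM => //.
  by rewrite ler_norml; apply/andP; split;
    [have := sqr_ge0 (v i 0 + v j 0) | have := sqr_ge0 (v i 0 - v j 0)]; lra.
by rewrite quadE; have : n%:R * e * S < S; [rewrite gtr_pMl | lra].
Qed.

End NearIdentity.

Lemma posdefmx_unitmx {F : realFieldType} {n} (Z : 'M[F]_n) :
  posdefmx Z -> Z \in unitmx.
Proof.
move=> [_ Zpos]; rewrite -row_free_unit -kermx_eq0.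
apply/eqP/row_matrixP => i; rewrite row0; set u := row i _.
have uZ : u *m Z = 0 by apply/sub_kermxP; rewrite row_sub.
apply/eqP; apply: contraT => u_neq0.
have := Zpos u^T; rewrite trmxK uZ mul0mx mxE ltxx -trmx0 (inj_eq trmx_inj).
by move=> /(_ u_neq0).
Qed.

(** Two matrices that are mutually inverse on the image of an orthogonal
    projection and vanish on its kernel are pseudoinverse to each other. *)
Lemma moore_penrose_projection {F : realFieldType} {n} (P A B : 'M[F]_n) :
  P^T = P -> A *m B = P -> B *m A = P -> P *m A = A -> P *m B = B ->
  moore_penrose A B.
Proof. by move=> Psym AB BA PA PB; split; rewrite ?AB ?BA ?PA ?PB. Qed.

Section CenteredPseudoinverse.
Context {F : realFieldType} {n : nat}.
Local Notation one := (const_mx 1 : 'cV[F]_n).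
Local Notation center := (1%:M - n%:R^-1 *: (one *m one^T)).

Lemma center_sym : center^T = center.
Proof. by rewrite linearB /= linearZ /= trmx_mul trmxK trmx1. Qed.

Lemma center_one : (0 < n)%N -> center *m one = 0.
Proof.
move=> n_gt0; rewrite mulmxBl mul1mx -scalemxAl -mulmxA.
have -> : one^T *m one = n%:R%:M.
  apply/matrixP => i j; rewrite !mxE !ord1.
  under eq_bigr do rewrite !mxE mulr1.
  by rewrite sumr_const card_ord.
by rewrite mul_mx_scalar scalerA mulVf ?pnatr_eq0 -?lt0n // scale1r subrr.
Qed.

(** Write [P] for the centering projection and [B] for [Z^-1 - w w^T / s].
    Subtracting [w w^T / s] is the rank-one correction that makes [B] kill the
    all-ones vector [1], since [Z^-1 1 = w] and [w^T 1 = s]; so [P B = B].  And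
    [P Z B = P (I - 1 w^T / s) = P] because [Z w = 1] and [P 1 = 0]. *)
Lemma moore_penrose_centered (Z : 'M[F]_n) (w := invmx Z *m one)
    (s := \sum_i w i 0) :
  (0 < n)%N -> Z^T = Z -> Z \in unitmx -> s != 0 ->
  moore_penrose (2^-1 *: (center *m Z *m center))
                (2 *: (invmx Z - s^-1 *: (w *m w^T))).
Proof.
move=> n_gt0 Zsym Zunit s_neq0.
set P := center; set A := P *m Z *m P; set B := invmx Z - _.
have Psym : P^T = P := center_sym.
have Pone : P *m one = 0 := center_one n_gt0.
have Gsym : (invmx Z)^T = invmx Z by rewrite trmx_inv Zsym.
have Asym : A^T = A by rewrite /A !trmx_mul Psym Zsym mulmxA.
have Bsym : B^T = B by rewrite /B linearB /= linearZ /= trmx_mul trmxK Gsym.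
have wone : w^T *m one = s%:M.
  apply/matrixP => i j; rewrite !mxE !ord1.
  by apply: eq_bigr => k _; rewrite !mxE mulr1.
have Bone : B *m one = 0.
  rewrite mulmxBl -scalemxAl -mulmxA wone mul_mx_scalar scalerA.
  by rewrite mulVf // scale1r subrr.
have PB : P *m B = B.
  rewrite mulmxBl mul1mx -scalemxAl -mulmxA -[B in one^T *m B]Bsym -trmx_mul.
  by rewrite Bone trmx0 mulmx0 scaler0 subr0.
have PP : P *m P = P.
  by rewrite {2}/P mulmxBr mulmx1 -scalemxAr mulmxA Pone mul0mx scaler0 subr0.
have AB : A *m B = P.
  rewrite /A -mulmxA PB -mulmxA mulmxBr mulmxV // -scalemxAr.
  rewrite [Z *m (w *m _)]mulmxA [Z *m w]mulmxA mulmxV // mul1mx.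
  by rewrite mulmxBr mulmx1 -scalemxAr mulmxA Pone mul0mx scaler0 subr0.
have BA : B *m A = P by rewrite -Asym -Bsym -trmx_mul AB Psym.
have half2 : 2^-1 * 2 = 1 :> F by rewrite mulVf ?pnatr_eq0.
apply: (moore_penrose_projection Psym).
- by rewrite -scalemxAl -scalemxAr scalerA AB half2 scale1r.
- by rewrite -scalemxAl -scalemxAr scalerA BA mulrC half2 scale1r.
- by rewrite -scalemxAr /A !mulmxA PP.
- by rewrite -scalemxAr PB.
Qed.

End CenteredPseudoinverse.

(** With [e = 1 / (8 n)] the weights lie in [[3/4, 5/4]], so [s <= 5 n / 4], while
    off-diagonal entries of [Z^-1] are at most [2 e]; then
    [2 e s <= 5/16 < 9/16 <= w_i w_j], which is [c_ij > 0]. *)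
Lemma near_identity_strongly_posdef (R : realType) (X : finMetricType R) :
  (0 < #|X|)%N -> near_identity (8 * #|X|%:R)^-1 (similaritymx X) ->
  strongly_positive_definite X.
Proof.
set n := #|X|; set e := _^-1; set Z := similaritymx X => n_gt0 Znear.
have nR_gt0 : 0 < n%:R :> R by rewrite ltr0n.
have ne : n%:R * e = 8^-1 by rewrite /e invfM mulrCA mulfV ?gt_eqF// mulr1.
have e_gt0 : 0 < e by rewrite invr_gt0 mulr_gt0.
have Zsym : Z^T = Z by apply/matrixP => i j; rewrite !mxE metric_sym.
have Zpos : posdefmx Z.
  by apply: near_identity_posdef Zsym Znear _; rewrite ne; lra.
have Zunit := posdefmx_unitmx Zpos.
pose G := invmx Z; pose w := weighting X.
have w_near i : `|w i 0 - 1| <= 4^-1.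
  have Zw : Z *m w = const_mx 1 by rewrite mulmxA mulmxV // mul1mx.
  have := near_identity_solution Znear _ Zw i.
  rewrite ne [const_mx _ _ _]mxE => /(_ ltac:(lra)).
  under eq_bigr do rewrite mxE normr1.
  rewrite sumr_const card_ord => /le_trans; apply.
  by rewrite -mulrA [e * _]mulrC ne; lra.
have w_bounds i : 3 / 4 <= w i 0 <= 5 / 4.
  by have := w_near i; rewrite ler_norml; lra.
have G_offdiag i j : i != j -> G i j <= 2 * e.
  move=> ij.
  have ZG : Z *m col j G = col j 1%:M by rewrite !colE mulmxA mulmxV.
  have := near_identity_solution Znear _ ZG i.
  rewrite ne !mxE (negPf ij) subr0 => /(_ ltac:(lra)).
  have -> : \sum_k `|col j (1%:M : 'M[R]_n) k 0| = 1.
    rewrite (bigD1 j) //= !mxE eqxx normr1 big1 ?addr0 // => k kj.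
    by rewrite !mxE (negPf kj) normr0.
  by rewrite mulr1; apply: le_trans (ler_norm _).
pose s := \sum_i w i 0.
have s_le : s <= 5 / 4 * n%:R.
  have -> : 5 / 4 * n%:R = \sum_(i < n) (5 / 4) :> R.
    by rewrite sumr_const card_ord mulr_natr.
  by apply: ler_sum => i _; case/andP: (w_bounds i).
have s_gt0 : 0 < s.
  apply: lt_le_trans (_ : \sum_(i < n) (3 / 4) <= s).
    by rewrite sumr_const card_ord pmulrn_lgt0 //; lra.
  by apply: ler_sum => i _; case/andP: (w_bounds i).
split=> // [x y xy|x]; last by have := w_bounds (enum_rank x); lra.
have ij : enum_rank x != enum_rank y by rewrite (inj_eq enum_rank_inj).
rewrite /c_coef; move: (enum_rank x) (enum_rank y) ij => i j ij.
have entry (A : 'M[R]_n) (v : 'cV[R]_n) :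
    (2 *: (A - s^-1 *: (v *m v^T))) i j = 2 * (A i j - v i 0 * v j 0 / s).
  by rewrite !mxE big_ord1 !mxE [_ / s]mulrC.
have Kpinv : moore_penrose (Kmx X) (2 *: (G - s^-1 *: (w *m w^T))).
  exact: moore_penrose_centered n_gt0 Zsym Zunit (lt0r_neq0 s_gt0).
rewrite (mp_pinvmx_eq Kpinv).
rewrite entry -mulrN opprB mulr_gt0 // subr_gt0.
apply: (le_lt_trans (G_offdiag i j ij)); rewrite ltr_pdivlMr //.
apply: (@le_lt_trans _ _ (5 / 16)).
  have := ler_wpM2l (ltW e_gt0) s_le; move: ne; lra.
apply: (@lt_le_trans _ _ (3 / 4 * (3 / 4))); first by lra.
apply: ler_pM; [lra | lra | |]; first by case/andP: (w_bounds i).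
by case/andP: (w_bounds j).
Qed.

(** This crude bound turns the condition on [t] into a rational one, which gives
    an explicit threshold. *)
Lemma expRN_le_inv (R : realType) (x : R) : 0 < x -> expR (- x) <= x^-1.
Proof.
move=> x_gt0; rewrite expRN lef_pV2 ?posrE ?expR_gt0 //.
by have := expR_ge1Dx x; lra.
Qed.

Theorem proposition5p7 (R : realType) (X : finMetricType R)
    (X_nonempty : (0 < #|X|)%N) :
  exists T : R, 0 < T /\
    forall t : {posnum R}, T < t%:num ->
      strongly_positive_definite (rescale t X).
Proof.
pose N : R := 8 * #|X|%:R.
have N_gt0 : 0 < N by rewrite mulr_gt0 // ltr0n.
have term_ge0 (x y : X) : 0 <= N / mdist x y.
  by rewrite divr_ge0 ?mdist_ge0 // ltW.
(* Summing over all pairs serves as an upper bound for the maximum; the diagonal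
   terms are [N / 0 = 0]. *)
pose T := 1 + \sum_(x : X) \sum_(y : X) N / mdist x y.
have T_ge (x y : X) : N / mdist x y <= T.
  rewrite /T (bigD1 x) //= (bigD1 y) //=.
  have row_ge0 : 0 <= \sum_(i | i != y) N / mdist x i by exact: sumr_ge0.
  have rest_ge0 : 0 <= \sum_(i | i != x) \sum_j N / mdist i j.
    by apply: sumr_ge0 => i _; exact: sumr_ge0.
  by lra.
exists T; split.
  by rewrite ltr_pwDl // sumr_ge0 // => x _; exact: sumr_ge0.
move=> t Tt; apply: near_identity_strongly_posdef => // i j.
rewrite mxE mdist_rescale.
have [->|ij] := eqVneq i j.
  by rewrite mdistxx mulr0 oppr0 expR0 subrr normr0 invr_ge0 ltW.
rewrite subr0 ger0_norm ?expR_ge0 //.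
have d_gt0 : 0 < mdist (enum_val i : X) (enum_val j : X).
  rewrite lt_def mdist_ge0 andbT; apply: contra ij => /eqP /mdist_positivity.
  by move=> /enum_val_inj ->.
apply: (le_trans (expRN_le_inv _)); first by rewrite mulr_gt0.
rewrite lef_pV2 ?posrE ?mulr_gt0 ?ltr0n // -ler_pdivrMr //.
exact: le_trans (T_ge _ _) (ltW Tt).
Qed.
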